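(* Let $m,N\ge1$ be integers and $\xi_1,\dots,\xi_m\in\mathbb{C}$ such that $1,\xi_1,\dots,\xi_m$ are linearly independent over $\overline{\mathbb{Q}}$. Let $\Omega=\{\kappa\in\mathbb{N}^m:\ N-1\le|\kappa|\le N\}$, $\Theta=\{\kappa\in\mathbb{N}^m:\ |\kappa|=N\}$, let $(E_\kappa)_{\kappa\in\Omega}$ be the canonical basis of $\mathbb{C}^\Omega$ and $(e_j)_{1\le j\le m}$ that of $\mathbb{Z}^m$. For $\kappa\in\Theta$ put $Z_\kappa=E_\kappa+\sum_{j=1}^m\xi_jE_{\kappa-e_j}$, with the convention $E_{\kappa-e_j}=0$ if $\kappa_j=0$, and let $F=\mathrm{Span}\{Z_\kappa:\ \kappa\in\Theta\}$. Then for every vector subspace $R$ of $\mathbb{C}^\Omega$ defined over $\overline{\mathbb{Q}}$, $$\dim R\ \ge\ \Big(2-\frac{m-1}{N+m-1}\Big)\dim(F\cap R),$$ and equality holds if and only if $R=\{0\}$ or $R=\mathbb{C}^\Omega$.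
   Context: $|\kappa|=\kappa_1+\dots+\kappa_m$. A subspace of $\mathbb{C}^\Omega$ is defined over $\overline{\mathbb{Q}}$ if it has a $\mathbb{C}$-basis consisting of vectors in $\overline{\mathbb{Q}}^\Omega$. *)

(* Defs.v *)
(* Complex numbers are modelled as R[i] for an arbitrary
   R : realType (every realType is (isomorphic to) the real numbers). *)
From HB Require Import structures.
From mathcomp Require Import all_boot all_order all_algebra.
From mathcomp Require Import reals.
From mathcomp.real_closed Require Export complex.
Set Implicit Arguments. Unset Strict Implicit. Unset Printing Implicit Defensive.
Import Order.TTheory GRing.Theory Num.Theory.
Local Open Scope ring_scope.

Definition algebraicQ (C : fieldType) (x : C) : Prop :=
  exists2 p : {poly rat}, p != 0 & root (map_poly ratr p) x.

(* Multi-indices kappa in N^m with |kappa| <= N have all entries in [0, N];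
   Omega = {kappa : N - 1 <= |kappa| <= N}. *)
Definition weight (m N : nat) (k : {ffun 'I_m -> 'I_N.+1}) : nat :=
  (\sum_(i < m) val (k i))%N.

Definition Omega (m N : nat) : finType :=
  {k : {ffun 'I_m -> 'I_N.+1} | (N.-1 <= weight k <= N)%N}.

Definition inTheta (m N : nat) (k : Omega m N) : bool := weight (val k) == N.

Definition is_pred_at (m N : nat) (k l : Omega m N) (j : 'I_m) : bool :=
  (0 < val (val k j))%N &&
  [forall i, val (val l i) == (val (val k i) - (i == j))%N].

(* Coefficient of E_l in Z_k = E_k + sum_j xi_j E_{k - e_j}
   (terms with k_j = 0 omitted). *)
Definition Zcoef (C : fieldType) (m N : nat) (xi : 'I_m -> C)
    (k l : Omega m N) : C :=
  (l == k)%:R + \sum_(j < m) (is_pred_at k l j)%:R * xi j.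

Definition Zvec (C : fieldType) (m N : nat) (xi : 'I_m -> C) (k : Omega m N)
    : 'rV[C]_#|Omega m N| :=
  \row_(j < #|Omega m N|) Zcoef xi k (enum_val j).

Definition Fspace (C : fieldType) (m N : nat) (xi : 'I_m -> C)
    : 'M[C]_#|Omega m N| :=
  (\sum_(k : Omega m N | inTheta k) <<Zvec xi k>>)%MS.

(* A subspace (row space of A) is defined over Qbar if it is the row space
   of a matrix with entries in Qbar (i.e. it has a basis of Qbar-vectors). *)
Definition defined_over_Qbar (C : fieldType) (r n : nat) (A : 'M[C]_(r, n))
    : Prop :=
  exists s, exists B : 'M[C]_(s, n),
    (forall i j, algebraicQ (B i j)) /\ (A == B)%MS.

(* Main.v *)
Require Import Defs.
From HB Require Import structures.
From mathcomp Require Import all_boot all_order all_algebra.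
From mathcomp Require Import boolp reals.
From mathcomp.real_closed Require Import complex.
From mathcomp Require Import zify ring.
Set Implicit Arguments. Unset Strict Implicit. Unset Printing Implicit Defensive.
Import Order.TTheory GRing.Theory Num.Theory.
Local Open Scope ring_scope.

(** Write [V_n] for the span of the [E_k] with [|k| = n], [D_j E_k = E_(k - e_j)]
    and [D_z = sum_j z_j D_j], so that [F = F_xi] is the graph of [D_xi] on [V_N].
    The dimension of [F_z :&: R] is upper semicontinuous in [z], so by the
    Nullstellensatz it is at least [k = dim (F_xi :&: R)] for a set [Z] of
    [Qbar]-points [z] that lies in no finite union of proper affine subspaces.

    It remains to prove [k_(z1) + (2N + e - 2) k <= (N + e - 1) dim R] for every
    point [z1], where [R] is killed by [D_u] for [u] in a space of codimension [e].
    Choose [z2] in [Z] and put [L = z2 - z1].  The subspaces [R :&: ker D_L] (where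
    [e] drops by one) and [D_L R] (where [N] drops by one) satisfy the induction
    hypotheses, rank-nullity for [D_L] splits all dimensions accordingly, and
    [F_(z1) :&: F_(z2)] is contained in [ker D_L], which gives
    [k_(z1) + k_(z2) <= dim R + dim (F_(z1) :&: R :&: ker D_L)].  Summing the three
    inequalities proves the claim; if equality holds, it holds in all three, and
    this determines [dim R]. *)

(** * Stability over a dense set of points *)

Section Dense.
Variables (K : fieldType) (m : nat).

(* A pair [(a, H)] stands for the affine subspace [a + H]. *)
Definition avoids (z : 'rV[K]_m) (s : seq ('rV[K]_m * 'M[K]_m)) : bool :=
  all (fun p => ~~ (z - p.1 <= p.2)%MS) s.

Definition affinely_dense (Z : 'rV[K]_m -> Prop) : Prop :=
  forall s : seq ('rV[K]_m * 'M[K]_m),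
    all (fun p => \rank p.2 < m)%N s -> exists2 z, Z z & avoids z s.

(** Pigeonhole. If the top level set fails density on a list [s0], then appending [s0] to every list
    leaves only points of smaller value, and induction on [b] applies. *)
Lemma affinely_dense_fiber (Z : 'rV[K]_m -> Prop) (f : 'rV[K]_m -> nat) b :
  affinely_dense Z -> (forall z, Z z -> f z <= b)%N ->
  exists c, affinely_dense (fun z => Z z /\ f z = c).
Proof.
elim: b Z => [|b IH] Z dZ fb.
  exists 0%N => s /dZ [z Zz zs]; exists z => //; split=> //.
  by apply/eqP; rewrite -leqn0; exact: fb.
have [dfib|/existsNP [s0 /not_implyP [s0P s0Z]]] :=
  EM (affinely_dense (fun z => Z z /\ f z = b.+1)); first by exists b.+1.
have [||c dc] := IH (fun z => Z z /\ (f z <= b)%N).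
- move=> s sP; have [|z Zz] := dZ (s0 ++ s); first by rewrite all_cat s0P.
  rewrite /avoids all_cat => /andP[z0 zs]; exists z => //; split=> //.
  rewrite -ltnS ltn_neqAle fb // andbT; apply/eqP => fz.
  by apply: s0Z; exists z.
- by move=> z [].
by exists c => s /dc [z [[Zz _] fz] zs]; exists z.
Qed.

End Dense.

(** * Counting monomials of degree [n] in [e] variables; arithmetic of the induction *)

Definition multichoose n e := 'C((n + e).-1, n).

Lemma multichoose0 e : multichoose 0 e = 1%N.
Proof. exact: bin0. Qed.

Lemma multichooseS0 n : multichoose n.+1 0 = 0%N.
Proof. by rewrite /multichoose addn0 bin_small. Qed.

Lemma multichooseSS n e :
  multichoose n.+1 e.+1 = (multichoose n.+1 e + multichoose n e.+1)%N.
Proof. by rewrite /multichoose !addSn !addnS /= binS. Qed.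

Lemma multichoose_down n e :
  ((n + e) * multichoose n e = n.+1 * multichoose n.+1 e)%N.
Proof. by rewrite /multichoose addSn mul_bin_diag. Qed.

Lemma multichoose_left n e :
  (e * multichoose n e.+1 = (n + e) * multichoose n e)%N.
Proof.
rewrite multichoose_down /multichoose addnS /=.
by rewrite mul_bin_left addKn.
Qed.

Lemma multichoose1n e : multichoose 1 e = e.
Proof. by rewrite /multichoose add1n bin1. Qed.

Lemma multichoose1 n : multichoose n 1 = 1%N.
Proof. by rewrite /multichoose addn1 binn. Qed.

(** [Db], [D2] are the ranks of the kernel and image parts, [km], [k12] their fibers over [z1].
    Adding the bounds gives [c * (kb + k2) <= c * k], so each added bound is tight; the separate
    bound on [k12] then gives [k12 <= k2]. *)
Lemma stability_step_arith c a k kb k2 k1 km k12 Db D2 :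
    (0 < c -> k1 + c.+1 * k = a.+1 * (Db + D2) -> k <= kb + k2 ->
    km + c * kb <= a * Db -> c * k2 <= a * D2 -> k12 + c.-1 * k2 <= a * D2 ->
    k1 + k <= Db + D2 + km ->
  [/\ k = kb + k2, km + c * kb = a * Db, c * k2 = a * D2,
      k1 + k = Db + D2 + km & k12 <= k2])%N.
Proof.
case: c => // c _ eqD kle A B B1 C.
have ck : (c.+1 * (kb + k2) <= c.+1 * k)%N.
  by move: eqD A B C; rewrite !mulSn !mulnDr; lia.
have kE : k = (kb + k2)%N.
  by move: ck; rewrite leq_mul2l /= => ck; apply/eqP; rewrite eqn_leq kle.
move: eqD A B B1 C; rewrite kE !mulSn !mulnDr /= => eqD A B B1 C; split; lia.
Qed.

(** An extreme [Db] determines [D2]. If [Db = 0], then [D2] is twice [k2], which for [e > 0] forces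
    [k2 = 0]. If [Db] is maximal, then [km], [kb] and finally [k2] attain their bounds. *)
Lemma stability_eq_arith n e k kb k2 k1 km k12 Db D2 :
    (k <= k1 -> k1 <= km + k12 -> k = kb + k2 ->
    km + (n.+1.*2 + e) * kb = (n.+1 + e) * Db ->
    (n.+1.*2 + e) * k2 = (n.+1 + e) * D2 ->
    k1 + k = Db + D2 + km -> k12 <= k2 ->
    kb <= multichoose n.+2 e -> km <= multichoose n.+2 e ->
    k2 <= multichoose n.+1 e.+1 -> km <= Db -> kb <= Db ->
    Db = 0 \/ Db = multichoose n.+2 e + multichoose n.+1 e ->
  Db + D2 = 0 \/ Db + D2 = multichoose n.+2 e.+1 + multichoose n.+1 e.+1)%N.
Proof.
move=> k_le k1_le kE A B C k12_le kb_le km_le k2_le kmD kbD cases.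
(* For [e = 0] both values of [Db] are [0], and [k2 <= 1] leaves [0] and [2] for [D2]. *)
have zero_case : (e = 0 -> Db = 0 ->
    Db + D2 = 0 \/ Db + D2 = multichoose n.+2 e.+1 + multichoose n.+1 e.+1)%N.
  move=> e0 Db0; move: k2_le; rewrite e0 !multichoose1 => k2_le.
  have [k20|k21] : (k2 = 0 \/ k2 = 1)%N by lia.
    by left; lia.
  by right; lia.
have [e0|e_gt0] := posnP e.
  apply: zero_case => //; case: cases => // ->; by rewrite e0 !multichooseS0.
case: cases => DbE.
  left; have k1E : k1 = k2 by lia.
  have D2E : D2 = (k2 + k2)%N by lia.
  move: B; rewrite D2E -!muln2; nia.
right; have down := multichoose_down n.+1 e; have left := multichoose_left n.+1 e.
rewrite multichooseSS.
move: (multichoose n.+2 e) (multichoose n.+1 e) (multichoose n.+1 e.+1)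
  kb_le km_le k2_le DbE down left => b b' g kb_le km_le k2_le DbE down left.
have Db_eq : ((n.+1 + e) * Db = (n.+1.*2 + e).+1 * b)%N.
  by rewrite DbE mulnDr down -mulnDl -muln2; congr (_ * _)%N; lia.
have [kmE kbE] : km = b /\ kb = b.
  have : ((n.+1.*2 + e) * kb <= (n.+1.*2 + e) * b)%N by rewrite leq_mul2l kb_le orbT.
  move: A; rewrite Db_eq mulSn => A AA; split; first by lia.
  apply/eqP; rewrite -(@eqn_pmul2l (n.+1.*2 + e)) //; lia.
have D2E : (k2 + k2 = b' + D2)%N by lia.
have k2g : (e * k2 = e * g)%N.
  rewrite left; move: (congr1 (muln (n.+1 + e)) D2E).
  rewrite !mulnDr -B -muln2; nia.
have k2E : k2 = g by apply/eqP; rewrite -(eqn_pmul2l e_gt0) k2g.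
by lia.
Qed.

(** * Commuting lowering operators on a graded space *)

Section Stability.
Variables (K : fieldType) (m d : nat).
Variables (Dj : 'I_m -> 'M[K]_d) (V : nat -> 'M[K]_d).

Definition lower n : 'M[K]_d := if n is n'.+1 then V n' else 0.

Hypothesis DjC : forall i j, Dj i *m Dj j = Dj j *m Dj i.
Hypothesis VDj : forall n j, (V n *m Dj j <= lower n)%MS.
Hypothesis Vdirect : forall n, (V n :&: lower n)%MS = 0.
Hypothesis V_inj : forall n (x : 'rV[K]_d),
  (x <= V n.+1)%MS -> (forall j, x *m Dj j = 0) -> x = 0.
Hypothesis V0_rank : (\rank (V 0) <= 1)%N.

Definition der (u : 'rV[K]_m) : 'M[K]_d := \sum_j u 0 j *: Dj j.
Definition unip (z : 'rV[K]_m) : 'M[K]_d := 1%:M + der z.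

Lemma derB u v : der (u - v) = der u - der v.
Proof.
rewrite /der -sumrB; apply: eq_bigr => j _.
by rewrite !mxE scalerDl scaleNr.
Qed.

Lemma der_delta j : der (delta_mx 0 j) = Dj j.
Proof.
rewrite /der (bigD1 j) //= mxE !eqxx scale1r big1 ?addr0 // => i /negbTE ij.
by rewrite mxE ij andbF scale0r.
Qed.

Lemma derC u v : der u *m der v = der v *m der u.
Proof.
rewrite /der !mulmx_suml; under eq_bigr do rewrite mulmx_sumr.
under [RHS]eq_bigr do rewrite mulmx_sumr.
rewrite exchange_big; apply: eq_bigr => i _; apply: eq_bigr => j _.
by rewrite -!scalemxAl -!scalemxAr DjC !scalerA mulrC.
Qed.

Lemma unip_derC z u : unip z *m der u = der u *m unip z.
Proof. by rewrite /unip mulmxDl mulmxDr mul1mx mulmx1 derC. Qed.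

Lemma V_der n u : (V n *m der u <= lower n)%MS.
Proof.
rewrite /der mulmx_sumr summx_sub // => j _.
by rewrite -scalemxAr scalemx_sub.
Qed.

Lemma sub_V_der n r (X : 'M_(r, d)) u : (X <= V n)%MS -> (X *m der u <= lower n)%MS.
Proof. by move=> XV; apply: submx_trans (V_der n u); apply: submxMr. Qed.

Lemma direct_eq0 n r (X Y : 'M_(r, d)) :
  (X <= V n)%MS -> (Y <= lower n)%MS -> X + Y = 0 -> X = 0.
Proof.
move=> XV YV /eqP; rewrite addr_eq0 => /eqP XY.
apply/eqP; rewrite -submx0 -(Vdirect n) sub_capmx XV XY.
by rewrite -scaleN1r scalemx_sub.
Qed.

Lemma unip_inj n r (X : 'M_(r, d)) z : (X <= V n)%MS -> X *m unip z = 0 -> X = 0.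
Proof.
move=> XV; rewrite /unip mulmxDr mulmx1.
by apply: (direct_eq0 XV); apply: sub_V_der.
Qed.

Lemma rank_V_unip n z : \rank (V n *m unip z) = \rank (V n).
Proof.
rewrite -[RHS](mxrank_mul_ker _ (unip z)).
suff -> : (V n :&: kermx (unip z))%MS = 0 by rewrite mxrank0 addn0.
apply: (@unip_inj n _ _ z); first exact: capmxSl.
by apply/sub_kermxP; exact: capmxSr.
Qed.

Definition killed r (U : 'M[K]_m) (X : 'M[K]_(r, d)) :=
  forall u : 'rV[K]_m, (u <= U)%MS -> X *m der u = 0.

Lemma killedS r r' (U : 'M_m) (X : 'M_(r, d)) (Y : 'M_(r', d)) :
  (X <= Y)%MS -> killed U Y -> killed U X.
Proof.
move=> XY kY u uU; apply/eqP; rewrite -submx0.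
by apply: submx_trans (submxMr _ XY) _; rewrite kY // sub0mx.
Qed.

Lemma killed_der r (U : 'M_m) (X : 'M_(r, d)) u : killed U X -> killed U (X *m der u).
Proof. by move=> kX v /kX Xv; rewrite -mulmxA derC mulmxA Xv mul0mx. Qed.

Lemma killed_ker r (U : 'M_m) (X : 'M_(r, d)) u :
  killed U X -> killed (U + u)%MS (X :&: kermx (der u))%MS.
Proof.
move=> kX v /sub_addsmxP [[a b] /= ->].
have -> : der (a *m U + b *m u) = der (a *m U) + b 0 0 *: der u.
  rewrite {1}[b]mx11_scalar mul_scalar_mx -[b 0 0 *: u]opprK derB.
  congr (_ + _); rewrite /der scaler_sumr -sumrN; apply: eq_bigr => j _.
  by rewrite !mxE scaleNr opprK scalerA.
rewrite mulmxDr -scalemxAr.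
rewrite (killedS (capmxSl _ _) kX) ?submxMl // add0r.
have /sub_kermxP -> := capmxSr X (kermx (der u)).
by rewrite scaler0.
Qed.

Lemma exists_outside (U : 'M[K]_m) : (\rank U < m)%N -> exists u : 'rV_m, ~~ (u <= U)%MS.
Proof.
move=> rU; have /row_subPn[i ui] : ~~ ((1%:M : 'M_m) <= U)%MS.
  by apply/negP => /mxrankS; rewrite mxrank1; lia.
by exists (row i 1%:M).
Qed.

Lemma rank_add_outside (U : 'M[K]_m) (u : 'rV_m) :
  ~~ (u <= U)%MS -> \rank (U + u)%MS = (\rank U).+1.
Proof.
move=> uU; have lt : (U < U + u)%MS.
  by rewrite ltmxE addsmxSl; apply: contra uU => /(submx_trans (addsmxSr _ _)).
have := rank_ltmx lt; have := mxrank_adds_leqif U u => -[+ _].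
have := rank_leq_row u; lia.
Qed.

Lemma full_killed n r (U : 'M_m) (X : 'M_(r, d)) :
  \rank U = m -> (X <= V n.+1)%MS -> killed U X -> X = 0.
Proof.
move=> rU XV kX; apply/row_matrixP => i; rewrite row0.
apply: (@V_inj n); first exact: submx_trans (row_sub _ _) XV.
move=> j; rewrite -row_mul -der_delta kX ?row0 //.
by apply: submx_full; rewrite /row_full rU.
Qed.

(** For [u] outside [U], rank-nullity for [der u] splits [X] into a kernel killed by the larger
    space [U + u] and an image of weight one less; the two bounds add up by Pascal's rule. *)
Lemma rank_killed e n r (U : 'M_m) (X : 'M_(r, d)) :
  (\rank U + e = m)%N -> (X <= V n)%MS -> killed U X ->
  (\rank X <= multichoose n e)%N.
Proof.
have V0 e' r' (Y : 'M_(r', d)) : (Y <= V 0)%MS -> (\rank Y <= multichoose 0 e')%N.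
  by move=> /mxrankS /leq_trans ->; rewrite // multichoose0.
elim: e n r U X => [|e IHe] n r U X rU XV kX.
  case: n XV => [/V0 //|n] XV; rewrite (full_killed _ XV kX) ?mxrank0 //.
  by rewrite -[RHS]rU addn0.
elim: n r X XV kX => [|n IHn] r X XV kX; first exact: V0.
have [|u uU] := @exists_outside U; first by lia.
rewrite -(mxrank_mul_ker X (der u)) multichooseSS addnC leq_add //.
  apply: (IHe _ _ (U + u)%MS); first by rewrite rank_add_outside // addSnnS.
    exact: submx_trans (capmxSl _ _) XV.
  exact: killed_ker.
by apply: IHn; [exact: sub_V_der XV | exact: killed_der].
Qed.

(* [V n *m unip z] is the graph of [der z] on [V n], inside [V n + lower n]. *)
Definition fiber n (X : 'M[K]_d) (z : 'rV[K]_m) : 'M[K]_d :=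
  (V n *m unip z :&: X)%MS.

(** Since [unip z] commutes with [der u] and is injective on each weight, the weight-[n] part of the
    fiber is killed by [U] as well. *)
Lemma rank_fiber_killed e n U X z :
  (\rank U + e = m)%N -> killed U X -> (\rank (fiber n X z) <= multichoose n e)%N.
Proof.
move=> rU kX; have /submxP[Y fE] : (fiber n X z <= V n *m unip z)%MS := capmxSl _ _.
have -> : fiber n X z = (Y *m V n) *m unip z by rewrite fE mulmxA.
apply: leq_trans (mxrankM_maxl _ _) _.
apply: (rank_killed rU); first exact: submxMl.
move=> u uU; have: fiber n X z *m der u = 0 by apply: (killedS (capmxSr _ _) kX).
rewrite fE -mulmxA -mulmxA unip_derC !mulmxA.
move=> W0; have := sub_V_der u (submxMl Y (V n)).
move: (_ *m der u) W0 => W {fE}; case: n => [|n] W0 /= WV.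
  by apply/eqP; rewrite -submx0.
exact: unip_inj WV W0.
Qed.

Lemma fiber_full_killed n U X z :
  \rank U = m -> killed U X -> \rank (fiber n.+1 X z) = 0%N.
Proof.
move=> rU kX; apply/eqP; rewrite -leqn0 -(multichooseS0 n).
by apply: (@rank_fiber_killed 0%N) kX; rewrite addn0.
Qed.

Lemma rank_fiber_split n X z u :
  \rank (fiber n X z) =
  (\rank (fiber n (X :&: kermx (der u))%MS z) + \rank (fiber n X z *m der u))%N.
Proof. by rewrite -(mxrank_mul_ker _ (der u)) addnC /fiber capmxA. Qed.

Lemma fiber_der n X z u :
  (fiber n.+1 X z *m der u <= fiber n (X *m der u) z)%MS.
Proof.
rewrite /fiber sub_capmx submxMr ?capmxSr // andbT.
apply: submx_trans (submxMr _ (capmxSl _ _)) _.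
by rewrite -mulmxA unip_derC mulmxA submxMr // (V_der n.+1).
Qed.

(** Comparing weights in [x + x *m der z1 = y + y *m der z2] gives [x = y], so [der (z2 - z1)] kills
    [x]; by commutation it kills the whole vector. *)
Lemma fiber_cap n X z1 z2 :
  (fiber n.+1 X z1 :&: fiber n.+1 X z2 <=
    fiber n.+1 (X :&: kermx (der (z2 - z1)))%MS z1)%MS.
Proof.
set Y := (_ :&: _)%MS; have Y1 : (Y <= V n.+1 *m unip z1)%MS.
  by apply: submx_trans (capmxSl _ _) _; apply: capmxSl.
have YX : (Y <= X)%MS by apply: submx_trans (capmxSl _ _) _; apply: capmxSr.
rewrite /fiber !sub_capmx Y1 YX /=; apply/sub_kermxP.
have /submxP[a aE] := Y1.
have /submxP[b bE] : (Y <= V n.+1 *m unip z2)%MS.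
  by apply: submx_trans (capmxSr _ _) _; apply: capmxSl.
pose x := a *m V n.+1; pose y := b *m V n.+1.
have xV : (x <= V n.+1)%MS by apply: submxMl.
have yV : (y <= V n.+1)%MS by apply: submxMl.
have Ex : Y = x + x *m der z1 by rewrite aE mulmxA /unip mulmxDr mulmx1.
have Ey : Y = y + y *m der z2 by rewrite bE mulmxA /unip mulmxDr mulmx1.
have xy : x = y.
  apply/eqP; rewrite -subr_eq0; apply/eqP.
  apply: (@direct_eq0 n.+1 _ _ (x *m der z1 - y *m der z2)).
  - by rewrite addmx_sub // -scaleN1r scalemx_sub.
  - by rewrite addmx_sub ?sub_V_der // -scaleN1r scalemx_sub ?sub_V_der.
  by rewrite addrACA -opprD -Ex -Ey subrr.
have xL : x *m der (z2 - z1) = 0.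
  by rewrite derB mulmxBr; move: Ey; rewrite {1}Ex -xy => /addrI ->; rewrite subrr.
by rewrite Ex mulmxDl -mulmxA derC mulmxA xL mul0mx addr0.
Qed.

Lemma hyperplane_step e n U X Z k z1 :
    (\rank U + e.+1 = m)%N -> (X <= V n.+1 + V n)%MS -> killed U X ->
    affinely_dense Z -> (forall z, Z z -> k <= \rank (fiber n.+1 X z))%N ->
  exists U' Xb X2 Z' kb k2,
    [/\ (\rank U' + e = m)%N, (Xb <= V n.+1 + V n)%MS & killed U' Xb] /\
    [/\ (X2 <= V n + lower n)%MS, killed U X2 & \rank X = (\rank Xb + \rank X2)%N] /\
    [/\ affinely_dense Z',
        forall z, Z' z -> (kb <= \rank (fiber n.+1 Xb z))%N,
        forall z, Z' z -> (k2 <= \rank (fiber n X2 z))%N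
      & (k <= kb + k2)%N] /\
    (\rank (fiber n.+1 X z1) + k <= \rank X + \rank (fiber n.+1 Xb z1))%N /\
    (\rank (fiber n.+1 X z1) <= \rank (fiber n.+1 Xb z1) + \rank (fiber n X2 z1))%N.
Proof.
move=> rU XV kX dZ kZ.
(* [U] is proper, so density gives [z2] outside [z1 + U], and adding [u] enlarges [U]. *)
have [|z2 Zz2] := dZ [:: (z1, U)]; first by rewrite /= andbT; lia.
rewrite /avoids /= andbT => z12; set u := z2 - z1 in z12.
pose Xb := (X :&: kermx (der u))%MS.
(* Two passages to a dense level set make both terms of rank-nullity constant, so that [kb + k2] is
   the rank of one fiber of [X], hence at least [k]. *)
have [||kb dkb] := @affinely_dense_fiber _ _ Z (fun z => \rank (fiber n.+1 Xb z)) d.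
- exact: dZ.
- by move=> z _; exact: rank_leq_row.
have [||k2 dk2] := @affinely_dense_fiber _ _
  (fun z => Z z /\ \rank (fiber n.+1 Xb z) = kb)
  (fun z => \rank (fiber n.+1 X z *m der u)) d.
- exact: dkb.
- by move=> z _; exact: rank_leq_row.
exists (U + u)%MS, Xb, (X *m der u), (fun z => (Z z /\
  \rank (fiber n.+1 Xb z) = kb) /\ \rank (fiber n.+1 X z *m der u) = k2), kb, k2.
split; [split|split; [split|split; [split; first exact: dk2|split]]].
- by rewrite rank_add_outside // addSnnS.
- exact: submx_trans (capmxSl _ _) XV.
- exact: killed_ker.
- apply: submx_trans (submxMr _ XV) _; rewrite addsmxMr addsmxS //.
    exact: (V_der n.+1).
  exact: V_der.
- exact: killed_der.
- by rewrite -(mxrank_mul_ker X (der u)) addnC.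
- by move=> z [[_ <-]].
- by move=> z [_ <-]; apply: mxrankS; exact: fiber_der.
- have [//|z [[Zz <-] <-] _] := dk2 [::].
  by rewrite -rank_fiber_split; exact: kZ.
(* Both fibers lie in [X], which bounds their intersection from below, while [fiber_cap] puts it
   inside the fiber of [Xb]. *)
- have := mxrank_sum_cap (fiber n.+1 X z1) (fiber n.+1 X z2).
  have : (\rank (fiber n.+1 X z1 + fiber n.+1 X z2) <= \rank X)%N.
    by apply: mxrankS; rewrite addsmx_sub !capmxSr.
  have := mxrankS (fiber_cap n X z1 z2); have := kZ _ Zz2; rewrite -/u -/Xb; lia.
by rewrite (rank_fiber_split _ _ _ u) leq_add2l mxrankS // fiber_der.
Qed.

(** The outer induction on [e] serves [Xb], the inner one on [n] serves [X2]; at [e = 0] all fibers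
    vanish. *)
Lemma stability_ineq e n U X Z k z1 :
    (\rank U + e = m)%N -> (X <= V n.+1 + V n)%MS -> killed U X ->
    affinely_dense Z -> (forall z, Z z -> k <= \rank (fiber n.+1 X z))%N ->
  (\rank (fiber n.+1 X z1) + (n.*2 + e) * k <= (n + e) * \rank X)%N.
Proof.
elim: e n U X Z k z1 => [|e IHe] n U X Z k z1.
  rewrite !addn0 => rU _ kX dZ kZ; rewrite (fiber_full_killed _ _ rU) //.
  have [//|z /kZ + _] := dZ [::]; rewrite (fiber_full_killed _ _ rU) // leqn0.
  by move=> /eqP ->; rewrite muln0.
elim: n U X Z k z1 => [|n IHn] U X Z k z1 rU XV kX dZ kZ.
all: have [U' [Xb [X2 [Z' [kb [k2 []]]]]]] := hyperplane_step z1 rU XV kX dZ kZ.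
all: move=> [rU' XbV kXb] [[X2V kX2 rX] [[dZ' kbZ k2Z kle] [C _]]].
all: have A := IHe _ _ _ _ _ z1 rU' XbV kXb dZ' kbZ.
all: have [//|z zZ' _] := dZ' [::].
(* In weight [1] the image lies in [V 0], and the trivial bound suffices. *)
- have B : (k2 <= \rank X2)%N.
    by apply: leq_trans (k2Z z zZ') _; apply: mxrankS; exact: capmxSr.
  move: A B C kle; rewrite rX !add0n; nia.
(* At [z] in [Z'] the fiber of [X2] has rank at least [k2]; this extra [k2] makes its coefficient
   agree with that of [kb]. *)
- have B := IHn _ _ _ _ z rU X2V kX2 dZ' k2Z; have k2z := k2Z z zZ'.
  move: A B C kle k2z; rewrite rX doubleS -!muln2.
  set c := (n * 2)%N; rewrite !addSn !addnS !mulSn; nia.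
Qed.

Lemma full_killed_sum n r (U : 'M_m) (X : 'M_(r, d)) :
  \rank U = m -> (X <= V n.+2 + V n.+1)%MS -> killed U X -> X = 0.
Proof.
move=> rU /sub_addsmxP[[a b] /= XE] kX.
set x := a *m _ in XE; set y := b *m _ in XE.
have xV : (x <= V n.+2)%MS by apply: submxMl.
have yV : (y <= V n.+1)%MS by apply: submxMl.
have kx : killed U x.
  move=> u /kX; rewrite XE mulmxDl; apply: (@direct_eq0 n.+1).
    exact: sub_V_der xV.
  exact: sub_V_der yV.
have ky : killed U y by move=> u uU; have := kX u uU; rewrite XE mulmxDl kx // add0r.
by rewrite XE (full_killed rU xV kx) (full_killed rU yV ky) addr0.
Qed.

(** Both weights are positive so that, in the base case [e = 0], only zero is killed by all [Dj]. *)
Lemma stability_eq e n U X Z k z1 :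
    (\rank U + e = m)%N -> (X <= V n.+2 + V n.+1)%MS -> killed U X ->
    affinely_dense Z -> (forall z, Z z -> k <= \rank (fiber n.+2 X z))%N ->
    (\rank (fiber n.+2 X z1) + (n.+1.*2 + e) * k = (n.+1 + e) * \rank X)%N ->
  \rank X = 0%N \/ \rank X = (multichoose n.+2 e + multichoose n.+1 e)%N.
Proof.
elim: e U X Z k z1 => [|e IHe] U X Z k z1 rU XV kX dZ kZ eqX.
  by left; rewrite (full_killed_sum _ XV kX) ?mxrank0 // -[RHS]rU addn0.
(* The equality at [z1] against the inequality at a point of [Z] shows that the fiber over [z1] is
   at least as large. *)
have k_le : (k <= \rank (fiber n.+2 X z1))%N.
  have [//|z zZ _] := dZ [::]; have := kZ z zZ.
  have := stability_ineq z rU XV kX dZ kZ; rewrite -eqX; lia.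
have [U' [Xb [X2 [Z' [kb [k2 []]]]]]] := hyperplane_step z1 rU XV kX dZ kZ.
move=> [rU' XbV kXb] [[X2V kX2 rX] [[dZ' kbZ k2Z kle] [C k1le]]].
have A := stability_ineq z1 rU' XbV kXb dZ' kbZ.
have [//|z zZ' _] := dZ' [::].
have B := leq_trans (leq_add (k2Z z zZ') (leqnn _))
  (stability_ineq z rU X2V kX2 dZ' k2Z).
have B1 := stability_ineq z1 rU X2V kX2 dZ' k2Z.
have kb_le := leq_trans (kbZ z zZ') (rank_fiber_killed n.+2 z rU' kXb).
have km_le := rank_fiber_killed n.+2 z1 rU' kXb.
have k2_le := leq_trans (k2Z z zZ') (rank_fiber_killed n.+1 z rU kX2).
have km_X := mxrankS (capmxSr (V n.+2 *m unip z1) Xb).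
have kb_X := leq_trans (kbZ z zZ') (mxrankS (capmxSr (V n.+2 *m unip z) Xb)).
rewrite rX in eqX C *.
have eqX' : (\rank (fiber n.+2 X z1) + (n.+1.*2 + e).+1 * k =
    (n.+1 + e).+1 * (\rank Xb + \rank X2))%N by rewrite -!addnS.
have B' : ((n.+1.*2 + e) * k2 <= (n.+1 + e) * \rank X2)%N.
  by move: B; rewrite doubleS !addSn !addnS mulSn.
have B1' : (\rank (fiber n.+1 X2 z1) + (n.+1.*2 + e).-1 * k2 <=
    (n.+1 + e) * \rank X2)%N.
  by move: B1; rewrite doubleS !addSn !addnS.
have c0 : (0 < n.+1.*2 + e)%N by [].
have [k_eq Aeq Beq Ceq k12_le] := stability_step_arith c0 eqX' kle A B' B1' C.
have cases := IHe _ _ _ _ _ rU' XbV kXb dZ' kbZ Aeq.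
exact: (stability_eq_arith k_le k1le k_eq Aeq Beq Ceq k12_le kb_le km_le k2_le km_X kb_X cases).
Qed.

Lemma killed0 r (X : 'M_(r, d)) : killed 0 X.
Proof.
move=> u; rewrite submx0 => /eqP ->; rewrite /der big1 ?mulmx0 // => j _.
by rewrite mxE scale0r.
Qed.

Lemma rank_V n : (\rank (V n) <= multichoose n m)%N.
Proof. by apply: (@rank_killed _ _ _ 0) (killed0 _); rewrite ?mxrank0. Qed.

Theorem dense_fiber_ineq n X Z k :
    (X <= V n.+1 + V n)%MS -> affinely_dense Z ->
    (forall z, Z z -> k <= \rank (fiber n.+1 X z))%N ->
  ((n.*2 + m).+1 * k <= (n + m) * \rank X)%N.
Proof.
move=> XV dZ kZ; have [//|z zZ _] := dZ [::].
have rU : (\rank (0%R : 'M[K]_m) + m = m)%N by rewrite mxrank0.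
apply: leq_trans (stability_ineq z rU XV (killed0 X) dZ kZ).
by rewrite mulSn leq_add2r kZ.
Qed.

Theorem dense_fiber_eq n X Z k :
    (0 < m)%N -> (X <= V n.+1 + V n)%MS -> affinely_dense Z ->
    (forall z, Z z -> k <= \rank (fiber n.+1 X z))%N ->
    ((n.*2 + m).+1 * k = (n + m) * \rank X)%N ->
  \rank X = 0%N \/ \rank X = (multichoose n.+1 m + multichoose n m)%N.
Proof.
move=> m0 XV dZ kZ eqX; have [//|z zZ _] := dZ [::].
have rU : (\rank (0%R : 'M[K]_m) + m = m)%N by rewrite mxrank0.
have := stability_ineq z rU XV (killed0 X) dZ kZ; have := kZ z zZ.
have := rank_fiber_killed n.+1 z rU (killed0 X).
rewrite -eqX mulSn => bound kz ineq.
case: n XV kZ eqX bound kz ineq => [|n] XV kZ eqX bound kz ineq; last first.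
  (* Equality forces the fiber over [z] to have rank exactly [k], so [z1] may be [z]. *)
  by apply: (stability_eq rU XV (killed0 X) dZ kZ (z1 := z)); rewrite -eqX mulSn; lia.
move: eqX bound; rewrite multichoose0 multichoose1n !add0n => eqX bound.
(* In weight [1], coprimality of [m] and [m.+1] gives [m %| k], and [k <= m] leaves [k = 0] or
   [k = m]. *)
have : (m %| k)%N.
  by rewrite -(@Gauss_dvdr _ m.+1) ?coprimenS // eqX dvdn_mulr.
have [k0|k_gt0] := posnP k => [_|]; first by left; nia.
move/(dvdn_leq k_gt0) => mk; right; have kE : k = m by lia.
move: eqX; rewrite kE mulnC => /eqP; rewrite eqn_pmul2l // => /eqP <-.
by rewrite addn1.
Qed.
End Stability.

(** * Specialization of generic points *)

Section Specialization.
Variables (K C : fieldType).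
Hypothesis closedK : forall p : {poly K}, (1 < size p)%N -> exists x, root p x.

(* [K]-points of the variety of [K]-relations among the generators of [A]
   evaluated in [C] are Zariski dense. *)
Definition specializable (A : idomainType) (al : {rmorphism A -> C})
    (c : {rmorphism K -> A}) :=
  forall g, al g != 0 -> exists be : {rmorphism A -> K},
    [/\ forall a, be (c a) = a, be g != 0 & forall f, al f = 0 -> be f = 0].

Lemma exists_nonroot (p : {poly K}) : p != 0 -> exists x, p.[x] != 0.
Proof.
have [/eqP/size_poly1P [a a0 ->] _|s1 p0] := eqVneq (size p) 1%N.
  by exists 0; rewrite hornerC.
have ps1 : (1 < size p)%N by move: p0; rewrite -size_poly_gt0; lia.
have [|x] := closedK (p := p - 1%:P).
  by rewrite size_polyDl // size_polyN size_polyC oner_eq0.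
rewrite rootE !hornerE subr_eq0 => /eqP px.
by exists x; rewrite px oner_eq0.
Qed.

Section Step.
Variables (A : idomainType) (al : {rmorphism A -> C}) (c : {rmorphism K -> A}).
Variable xi : C.
Hypothesis spec : specializable al c.

Definition adjoin_eval : {rmorphism {poly A} -> C} := horner_eval xi \o map_poly al.
Definition adjoin_const : {rmorphism K -> {poly A}} := polyC \o c.

Local Notation "p ^al" := (map_poly al p) (at level 2, format "p ^al").

Lemma adjoin_evalE p : adjoin_eval p = p^al.[xi]. Proof. by []. Qed.

(** Truncation at the size of the image discards the top coefficients that [al] kills. *)
Lemma trim (p : {poly A}) : p^al != 0 ->
  exists q, [/\ q^al = p^al, al (lead_coef q) != 0 & size q = size p^al].
Proof.
move=> p0; pose q := take_poly (size p^al) p.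
have qE : q^al = p^al.
  apply/polyP => i; rewrite !coef_map coef_take_poly /=.
  case: ltnP => // si; rewrite rmorph0.
  by have := nth_default 0 si; rewrite coef_map.
have sq : size q = size p^al.
  apply/eqP; rewrite eqn_leq size_take_poly /= -qE; exact: size_poly.
exists q; split=> //; move: p0; rewrite -lead_coef_eq0 -qE.
by rewrite !lead_coefE coef_map qE sq.
Qed.

(* [h] plays the role of the minimal polynomial of [xi] over the image of [A]:
   its leading coefficient is only invertible after applying [al]. *)
Variables (h : {poly A}).
Hypothesis h_lead : al (lead_coef h) != 0.
Hypothesis h_root : adjoin_eval h = 0.
Hypothesis h_min :
  forall r, adjoin_eval r = 0 -> (size r^al < size h)%N -> r^al = 0.

Lemma size_map_lead (p : {poly A}) : al (lead_coef p) != 0 -> size p^al = size p.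
Proof. exact: size_map_poly_id0. Qed.

Lemma lead_neq0 (p : {poly A}) : al (lead_coef p) != 0 -> p != 0.
Proof. by apply: contraNneq => ->; rewrite lead_coef0 rmorph0. Qed.

(** Bezout with denominators cleared. A shortest [d] in the ideal of [g] and [h] divides both, up to
    powers of its leading coefficient. As [d] does not vanish at [xi], the cofactor of [h] does, and
    minimality of [h] makes [d] constant. *)
Lemma bezout_const g : adjoin_eval g != 0 ->
  exists b u w, al b != 0 /\ (u * g + w * h)^al = (b%:P)^al.
Proof.
move=> g0; pose I (p : {poly A}) := exists u w, p^al = (u * g + w * h)^al.
pose P s := `[< exists d, [/\ I d, al (lead_coef d) != 0 & size d = s] >].
have P_trim p : I p -> p^al != 0 -> P (size p^al).
  move=> [u [w pE]] /trim [q [qE q0 sq]]; apply/asboolP; exists q; split=> //.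
  by exists u, w; rewrite qE.
have gI : I g by exists 1, 0; rewrite mul1r mul0r addr0.
have ga0 : g^al != 0.
  by apply: contraNneq g0 => ga; rewrite adjoin_evalE ga horner0.
have exP : exists s, P s by exists (size g^al); exact: P_trim.
case: (ex_minnP exP) => s /asboolP[d [[u [w dE]] d_lead sd]] s_min.
have reduce p : I p -> exists k, al (lead_coef d ^+ k) *: p^al = (p %/ d)^al * d^al.
  move=> [u' [w' pE]]; exists (scalp p d).
  have eq := congr1 (map_poly al) (Pdiv.Idomain.divp_eq p d).
  suff r0 : (p %% d)^al = 0.
    by move: eq; rewrite rmorphD rmorphM /= map_polyZ /= r0 addr0.
  (* The pseudo-remainder is again in the ideal and shorter than [d]. *)
  apply/eqP/negP => /negP r0; have : (s <= size (p %% d)^al)%N.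
    apply/s_min/P_trim => //.
    exists ((lead_coef d ^+ scalp p d)%:P * u' - (p %/ d) * u).
    exists ((lead_coef d ^+ scalp p d)%:P * w' - (p %/ d) * w).
    have -> : (p %% d)^al =
        (lead_coef d ^+ scalp p d)%:P^al * p^al - (p %/ d)^al * d^al.
      by rewrite -!rmorphM -rmorphB mul_polyC Pdiv.Idomain.divp_eq addrC addKr.
    rewrite pE dE -!rmorphM -rmorphB; congr (map_poly al _).
    by rewrite !mulrDr !mulrBl -!mulrA; ring.
  move/leq_trans/(_ (size_poly _ _)).
  by rewrite leqNgt -sd Pdiv.Idomain.ltn_modp lead_neq0.
have [k1 gE] := reduce g gI.
have [|k2 hE] := reduce h; first by exists 0, 1; rewrite mul1r mul0r add0r.
have lead_k k : al (lead_coef d ^+ k) != 0 by rewrite rmorphXn expf_neq0.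
have dxi : d^al.[xi] != 0.
  apply: contraNneq g0 => d0; rewrite adjoin_evalE.
  move/(congr1 (horner^~ xi)): gE => /eqP.
  by rewrite hornerZ hornerM d0 mulr0 mulf_eq0 (negbTE (lead_k _)).
pose q := h %/ d.
have ha0 : h^al != 0 by rewrite -size_poly_gt0 size_map_lead ?size_poly_gt0 ?lead_neq0.
have q0 : q^al != 0.
  apply: contraNneq ha0 => q0; move/eqP: hE; rewrite -/q q0 mul0r.
  by rewrite scaler_eq0 (negbTE (lead_k _)).
have d0 : d^al != 0 by rewrite -size_poly_gt0 size_map_lead ?size_poly_gt0 ?lead_neq0.
have qxi : adjoin_eval q = 0.
  move/(congr1 (horner^~ xi)): hE; rewrite hornerZ hornerM -adjoin_evalE h_root mulr0.
  by move/esym/eqP; rewrite mulf_eq0 (negbTE dxi) orbF => /eqP.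
have size_q : size h = (size q^al + size d^al).-1.
  by rewrite -size_mul // -hE size_scale // size_map_lead.
have d1 : size d = 1%N.
  apply/eqP/negP => /negP d1; move: q0; rewrite h_min ?eqxx //.
  move: d0; rewrite -size_poly_gt0 size_q size_map_lead //; lia.
have /eqP/size_poly1P [b b0 dE'] := d1.
exists b, u, w; split; last by rewrite -dE -dE'.
by move: d_lead; rewrite dE' lead_coefC.
Qed.

(** Specialize [A] keeping [lead_coef h] and the Bezout constant nonzero, then send the variable to
    a root of the specialized [h]. The Bezout identity keeps [g] nonzero; pseudo-division by [h]
    sends every relation to zero. *)
Lemma adjoin_algebraic : specializable adjoin_eval adjoin_const.
Proof.
move=> g /bezout_const [b [u [w [b0 bE]]]].
have [|be [beK]] := spec (g := lead_coef h * b); first by rewrite rmorphM mulf_neq0.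
rewrite rmorphM mulf_eq0 negb_or => /andP[be_lead be_b] be_ker.
have be_map p q : p^al = q^al -> map_poly be p = map_poly be q.
  move=> pq; apply/polyP => i; rewrite !coef_map /=; apply/eqP.
  rewrite -subr_eq0 -rmorphB; apply/eqP/be_ker; rewrite rmorphB.
  by have := congr1 (fun p : {poly C} => p`_i) pq; rewrite !coef_map /= => ->; rewrite subrr.
have [|x hx] := closedK (p := map_poly be h).
  rewrite size_map_poly_id0 // ltnNge; apply/negP => /size1_polyC hC.
  move: h_root h_lead; rewrite adjoin_evalE hC map_polyC hornerC lead_coefC => ->.
  by rewrite eqxx.
exists (horner_eval x \o map_poly be : {rmorphism {poly A} -> K}); split=> /=.
- by move=> a; rewrite map_polyC /horner_eval hornerC /= beK.
- apply: contraNneq be_b => g0.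
  have := congr1 (horner^~ x) (be_map _ _ bE).
  rewrite rmorphD !rmorphM /= map_polyC !hornerE => <-.
  by move: g0; rewrite /horner_eval => ->; rewrite (rootP hx) !mulr0 addr0.
- move=> f; rewrite -[horner_eval _ _]/(adjoin_eval f) => f0; have eq := Pdiv.Idomain.divp_eq f h.
  have r0 : (f %% h)^al = 0.
    apply: h_min; last first.
      by apply: leq_ltn_trans (size_poly _ _) _; rewrite Pdiv.Idomain.ltn_modp lead_neq0.
    move/(congr1 adjoin_eval): eq; rewrite rmorphD rmorphM h_root mulr0 add0r => <-.
    by rewrite -mul_polyC [LHS]rmorphM f0 mulr0.
  have := congr1 (fun p => (map_poly be p).[x]) eq.
  rewrite rmorphD rmorphM /= map_polyZ /= !hornerE (rootP hx) mulr0 add0r.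
  rewrite (be_map (f %% h) 0) ?rmorph0 ?horner0 // => /eqP.
  by rewrite mulf_eq0 rmorphXn expf_eq0 (negbTE be_lead) andbF /= => /eqP.
Qed.

End Step.

(** Algebraic case: a shortest relation serves as [h]. Transcendental case: [al] kills all
    coefficients of every relation, so the variable may go to any point where the specialized [g] is
    nonzero. *)
Lemma adjoin_specializable (A : idomainType) (al : {rmorphism A -> C})
    (c : {rmorphism K -> A}) xi :
  specializable al c -> specializable (adjoin_eval al xi) (adjoin_const c).
Proof.
move=> spec.
have [[p0 [p0_root p0_neq0]]|transc] :=
    EM (exists p, adjoin_eval al xi p = 0 /\ map_poly al p != 0).
  pose P s := `[< exists h, [/\ al (lead_coef h) != 0, adjoin_eval al xi h = 0
                              & size h = s] >].
  have P_trim p : adjoin_eval al xi p = 0 -> map_poly al p != 0 -> P (size (map_poly al p)).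
    move=> px /trim [q [qE q0 sq]]; apply/asboolP; exists q; split=> //.
    by rewrite adjoin_evalE qE.
  have exP : exists s, P s by exists (size (map_poly al p0)); exact: P_trim.
  case: (ex_minnP exP) => s /asboolP[h [h_lead h_root sh]] s_min.
  apply: (adjoin_algebraic spec h_lead h_root) => r rx; rewrite sh ltnNge => sr.
  by apply/eqP/negP => /negP r0; move: sr; rewrite s_min // P_trim.
move=> g g0; have ga0 : map_poly al g != 0.
  by apply: contraNneq g0 => ga; rewrite adjoin_evalE ga horner0.
have [|be [beK be0 be_ker]] := spec (g`_(size (map_poly al g)).-1).
  by move: ga0; rewrite -lead_coef_eq0 lead_coefE coef_map.
have [|x gx] := exists_nonroot (p := map_poly be g).
  by apply: contraNneq be0 => gb; rewrite -coef_map gb coef0.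
exists (horner_eval x \o map_poly be : {rmorphism {poly A} -> K}); split=> //=.
  by move=> a; rewrite map_polyC /horner_eval hornerC /= beK.
move=> f f0; have fa : map_poly al f = 0.
  by apply/eqP/negP => /negP f1; apply: transc; exists f.
suff -> : map_poly be f = 0 by rewrite /horner_eval horner0.
apply/polyP => i; rewrite coef_map coef0 /=; apply: be_ker.
by rewrite -coef_map fa coef0.
Qed.

(** [A] is an iterated polynomial ring over [K]: coordinates are adjoined one by one, starting from
    the identity of [K]. *)
Lemma specializable_point (iota : {rmorphism K -> C}) n (xi : 'I_n -> C) :
  exists (A : idomainType) (al : {rmorphism A -> C}) (c : {rmorphism K -> A})
         (X : 'I_n -> A),
    [/\ specializable al c, forall a, al (c a) = iota a & forall i, al (X i) = xi i].
Proof.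
elim: n xi => [|n IH] xi.
  exists K, iota, idfun, (fun=> 0); split=> //; last by case.
  move=> g g0; exists idfun; split=> //=; first by rewrite -(fmorph_eq0 iota).
  by move=> f /eqP; rewrite fmorph_eq0 => /eqP.
have [A [al [c [X [spec alc alX]]]]] := IH (fun i => xi (lift ord0 i)).
exists {poly A}, (adjoin_eval al (xi ord0)), (adjoin_const c).
exists (fun i => if unlift ord0 i is Some j then (X j)%:P else 'X); split.
- exact: adjoin_specializable.
- by move=> a; rewrite adjoin_evalE /= map_polyC hornerC /= alc.
move=> i; case: unliftP => [j|] ->; rewrite adjoin_evalE.
  by rewrite map_polyC hornerC /= alX.
by rewrite map_polyX hornerX.
Qed.

End Specialization.

(** * The shift model *)

Lemma exists_unit_minor (F : fieldType) p q (M : 'M[F]_(p, q)) :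
  exists (f : 'I_(\rank M) -> 'I_p) (g : 'I_(\rank M) -> 'I_q),
    mxsub f g M \in unitmx.
Proof.
have free := maxrowsub_free M; set N := rowsub _ M in free.
have full : row_full N^T by rewrite /row_full mxrank_tr.
exists (maxrankfun M), (fullrankfun full).
rewrite -unitmx_tr.
suff -> : (mxsub (maxrankfun M) (fullrankfun full) M)^T =
    rowsub (fullrankfun full) N^T by exact: fullrowsub_unit.
by apply/matrixP => i j; rewrite !mxE.
Qed.

Lemma rank_mxsub (F : fieldType) p q p' q' (f : 'I_p' -> 'I_p) (g : 'I_q' -> 'I_q)
  (M : 'M[F]_(p, q)) : (\rank (mxsub f g M) <= \rank M)%N.
Proof.
have -> : mxsub f g M = rowsub f 1%:M *m M *m colsub g 1%:M.
  by rewrite mul_rowsub_mx mul1mx mulmx_colsub mulmx1; apply/matrixP => i j; rewrite !mxE.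
by apply: leq_trans (mxrankM_maxl _ _) (mxrankM_maxr _ _).
Qed.

(** A nonzero maximal minor over [K] comes from a minor over [A] that [al] cannot kill. *)
Lemma rank_specialize (A : comNzRingType) (K C : fieldType)
    (be : {rmorphism A -> K}) (al : {rmorphism A -> C}) p q (M : 'M[A]_(p, q)) :
  (forall f, al f = 0 -> be f = 0) ->
  (\rank (map_mx be M) <= \rank (map_mx al M))%N.
Proof.
move=> ker; have [f [g]] := exists_unit_minor (map_mx be M).
rewrite unitmxE unitfE -map_mxsub det_map_mx => det0.
apply: leq_trans (rank_mxsub f g _).
rewrite -map_mxsub mxrank_unit // unitmxE unitfE det_map_mx.
by apply: contra_neq det0; exact: ker.
Qed.

Section Shift.
Variables (m N : nat).
Local Notation M := {ffun 'I_m -> 'I_N.+1}.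
Local Notation d := #|{: M}|.

Definition shift (k : M) (j : 'I_m) : M := [ffun i => inord (k i - (i == j))%N].

(** The guard matters: truncated subtraction gives [shift k j = k] when [k j = 0]. *)
Definition below (k l : M) (j : 'I_m) : bool := (0 < k j)%N && (l == shift k j).

Lemma shiftE k j i : shift k j i = (k i - (i == j))%N :> nat.
Proof. by rewrite ffunE inordK //; have := ltn_ord (k i); lia. Qed.

Lemma belowE k l j :
  below k l j = (0 < k j)%N && [forall i, val (l i) == (val (k i) - (i == j))%N].
Proof.
rewrite /below; congr (_ && _); apply/eqP/forallP => [-> i|H].
  by rewrite -shiftE.
by apply/ffunP => i; apply/val_inj; rewrite /= shiftE; exact/eqP/H.
Qed.

Lemma weight_below k l j : below k l j -> weight k = (weight l).+1.
Proof.
case/andP => kj /eqP ->; rewrite /weight (bigD1 j) //= [in RHS](bigD1 j) //= shiftE eqxx.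
rewrite -addSn subn1 prednK //; congr (_ + _)%N; apply: eq_bigr => i /negbTE ij.
by rewrite shiftE ij subn0.
Qed.

Lemma below_inj k k' l j : below k l j -> below k' l j -> k = k'.
Proof.
case/andP => kj /eqP -> /andP[k'j /eqP e]; apply/ffunP => i; apply/val_inj.
have := congr1 (fun f : M => val (f i)) e; rewrite /= !shiftE.
by case: eqVneq => [->|_]; lia.
Qed.

Lemma below_comp (k l : M) i j :
  (0 < k i)%N && below (shift k i) l j = (0 < k j)%N && below (shift k j) l i.
Proof.
rewrite /below !shiftE [j == i]eq_sym.
have -> : shift (shift k i) j = shift (shift k j) i.
  by apply/ffunP => a; apply/val_inj; rewrite /= !shiftE; lia.
by case: eqP => [->|_] //; rewrite !subn0 !andbA [(0 < k i)%N && _]andbC.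
Qed.

(** The ring is arbitrary because these matrices are later specialized along ring morphisms. *)
Definition shift_mx (R : nzRingType) (j : 'I_m) : 'M[R]_d :=
  \matrix_(a, b) (below (enum_val a) (enum_val b) j)%:R.

Definition weight_mx (R : nzRingType) n : 'M[R]_d :=
  diag_mx (\row_a (weight (enum_val a) == n)%:R).

Lemma map_shift_mx (R S : nzRingType) (f : {rmorphism R -> S}) j :
  map_mx f (shift_mx R j) = shift_mx S j.
Proof. by apply/matrixP => a b; rewrite !mxE rmorph_nat. Qed.

Lemma map_weight_mx (R S : nzRingType) (f : {rmorphism R -> S}) n :
  map_mx f (weight_mx R n) = weight_mx S n.
Proof.
by rewrite map_diag_mx; congr diag_mx; apply/rowP => a; rewrite !mxE rmorph_nat.
Qed.

Variable F : fieldType.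
Local Notation D := (shift_mx F).
Local Notation V := (weight_mx F).

Lemma sub_weight_mxP n r (X : 'M[F]_(r, d)) :
  reflect (forall i b, weight (enum_val b) != n -> X i b = 0) (X <= V n)%MS.
Proof.
apply: (iffP idP) => [/submxP[Y ->] i b /negbTE bn|H].
  by rewrite mul_mx_diag !mxE bn mulr0.
suff -> : X = X *m V n by apply: submxMl.
apply/matrixP => i b; rewrite mul_mx_diag !mxE.
by have [bn|/H ->] := eqVneq; rewrite ?mulr1 ?mul0r.
Qed.

Lemma shift_mxC i j : D i *m D j = D j *m D i.
Proof.
have H a b i' j' : (D i' *m D j') a b =
    ((0 < enum_val a i')%N && below (shift (enum_val a) i') (enum_val b) j')%:R.
  rewrite mxE (bigD1 (enum_rank (shift (enum_val a) i'))) //= big1 ?addr0.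
    by rewrite !mxE enum_rankK /below eqxx andbT -natrM mulnb.
  move=> c ca; rewrite !mxE {1}/below; case: eqP => [e|_]; last by rewrite andbF mul0r.
  by move: ca; rewrite -e enum_valK eqxx.
by apply/matrixP => a b; rewrite !H below_comp.
Qed.

Lemma weight_shift_mx n j : (V n *m D j <= lower V n)%MS.
Proof.
have E a b : (V n *m D j) a b =
    ((weight (enum_val a) == n) && below (enum_val a) (enum_val b) j)%:R.
  by rewrite mul_diag_mx !mxE -natrM mulnb.
case: n E => [|n] E /=.
  rewrite submx0; apply/eqP/matrixP => a b; rewrite E mxE.
  by case: eqP => //= w; case: below (@weight_below (enum_val a) (enum_val b) j); rewrite ?w // => /(_ isT).
apply/sub_weight_mxP => a b bn; rewrite E; case: eqP => //= w.
case: below (@weight_below (enum_val a) (enum_val b) j) => // /(_ isT).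
by rewrite w => -[e]; rewrite -e eqxx in bn.
Qed.

Lemma weight_mx_direct n : (V n :&: lower V n)%MS = 0.
Proof.
case: n => [|n] /=; first by rewrite capmx0.
apply/matrixP => a b; rewrite mxE.
have /sub_weight_mxP H1 := capmxSl (V n.+1) (V n).
have /sub_weight_mxP H2 := capmxSr (V n.+1) (V n).
have [w|/H1 //] := eqVneq (weight (enum_val b)) n.+1.
by apply: H2; rewrite w; lia.
Qed.

(** If entry [j] of the index [a] is positive, only [a] is sent by [D j] to [shift a j], so the
    coordinate of [x *m D j] there is that of [x] at [a]. *)
Lemma shift_mx_inj n (x : 'rV[F]_d) :
  (x <= V n.+1)%MS -> (forall j, x *m D j = 0) -> x = 0.
Proof.
move=> /sub_weight_mxP xV xD; apply/rowP => a; rewrite [RHS]mxE.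
have [w|/xV //] := eqVneq (weight (enum_val a)) n.+1.
have [j aj] : exists j, (0 < enum_val a j)%N.
  apply/existsP; apply/negP => /pred0P a0; move: w; rewrite /weight big1 // => j _.
  by apply/eqP; rewrite -leqn0 leqNgt; have /= -> := a0 j.
have ba : below (enum_val a) (shift (enum_val a) j) j by rewrite /below aj eqxx.
have := congr1 (fun M : 'rV_d => M 0 (enum_rank (shift (enum_val a) j))) (xD j).
rewrite !mxE (bigD1 a) //= big1 ?addr0; first by rewrite !mxE enum_rankK ba mulr1.
move=> c ca; rewrite !mxE enum_rankK; case bc: below; last by rewrite mulr0.
by move: ca; rewrite (enum_val_inj (below_inj bc ba)) eqxx.
Qed.

Lemma rank_weight_mx0 : (\rank (V 0) <= 1)%N.
Proof.
pose a0 := enum_rank ([ffun=> ord0] : M).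
have -> : V 0 = (\col_a V 0 a a0) *m (delta_mx 0 a0 : 'rV_d).
  apply/matrixP => a b; rewrite !mxE big_ord1 !mxE eqxx /=.
  have wa : (weight (enum_val a) == 0)%N = (a == a0).
    rewrite /weight sum_nat_eq0; apply/forall_inP/eqP => [H|-> i _]; last first.
      by rewrite enum_rankK ffunE.
    by apply: enum_val_inj; rewrite enum_rankK; apply/ffunP => i; rewrite ffunE;
      apply/val_inj/eqP/H.
  rewrite wa [b == a0]eq_sym; case: (eqVneq a a0) => [->|_]; rewrite ?mulr0n ?mul0rn ?mul0r //.
  by rewrite mulr1n mul1r.
exact: leq_trans (mxrankM_maxr _ _) (rank_leq_row _).
Qed.

Lemma rank_weight_mx n : (\rank (V n) <= multichoose n m)%N.
Proof.
exact: (rank_V shift_mxC weight_shift_mx shift_mx_inj rank_weight_mx0).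
Qed.
End Shift.

(** * [Omega] inside the box of all multi-indices *)

Section Embedding.
Variables (m N : nat).
Local Notation M := {ffun 'I_m -> 'I_N.+1}.
Local Notation O := (Omega m N).

Definition embed (R : nzRingType) : 'M[R]_(#|{: O}|, #|{: M}|) :=
  \matrix_(a, b) (enum_val b == val (enum_val a))%:R.

Lemma map_embed (R S : nzRingType) (f : {rmorphism R -> S}) :
  map_mx f (embed R) = embed S.
Proof. by apply/matrixP => a b; rewrite !mxE rmorph_nat. Qed.

Variable F : fieldType.
Local Notation V := (@weight_mx m N F).
Local Notation J := (embed F).

Lemma embed_free : row_free J.
Proof.
apply/row_freeP; exists J^T; apply/matrixP => a b; rewrite !mxE.
rewrite (bigD1 (enum_rank (val (enum_val a)))) //= big1 ?addr0.
  rewrite !mxE enum_rankK eqxx mul1r (inj_eq val_inj) (inj_eq enum_val_inj).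
  by rewrite eq_sym.
move=> c ca; rewrite !mxE; case: eqP => [e|_]; last by rewrite mul0r.
by move: ca; rewrite -e enum_valK eqxx.
Qed.

Lemma embed_sub : (J <= V N + V N.-1)%MS.
Proof.
apply/row_subP => a.
have Hn n : weight (val (enum_val a)) = n -> (row a J <= V n)%MS.
  move=> wn; apply/sub_weight_mxP => i b bn; rewrite !mxE; case: eqP => // e.
  by rewrite e wn eqxx in bn.
have /andP[w1 w2] := valP (enum_val a).
have [w|w] : weight (val (enum_val a)) = N \/ weight (val (enum_val a)) = N.-1 by lia.
  by apply: submx_trans (Hn _ w) (addsmxSl _ _).
by apply: submx_trans (Hn _ w) (addsmxSr _ _).
Qed.

Lemma card_Omega_le :
  (#|{: O}| <= multichoose N m + multichoose N.-1 m)%N.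
Proof.
have /eqP <- := embed_free; apply: leq_trans (mxrankS embed_sub) _.
have := mxrank_sum_cap (V N) (V N.-1).
have := @rank_weight_mx m N F N; have := @rank_weight_mx m N F N.-1.
lia.
Qed.

(** The lower bound counts the multi-indices of weight [N] as tuples with sum [N]. *)
Lemma rank_weight_mx_top : (0 < m)%N -> \rank (V N) = multichoose N m.
Proof.
move=> m0; apply/eqP; rewrite eqn_leq rank_weight_mx /=.
pose S := [set k : M | weight k == N].
pose L : 'M[F]_(#|S|, #|{: M}|) := \matrix_(a, b) (enum_val b == enum_val a)%:R.
have LV : (L <= V N)%MS.
  apply/sub_weight_mxP => a b bn; rewrite mxE; case: eqP => // e.
  by have := enum_valP a; rewrite -e inE (negbTE bn).
have L_free : row_free L.
  apply/row_freeP; exists L^T; apply/matrixP => a b; rewrite !mxE.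
  rewrite (bigD1 (enum_rank (enum_val a))) //= big1 ?addr0.
    rewrite !mxE enum_rankK eqxx mul1r (inj_eq enum_val_inj).
    by rewrite eq_sym.
  move=> c ca; rewrite !mxE; case: eqP => [e|_]; last by rewrite mul0r.
  by move: ca; rewrite -e enum_valK eqxx.
have /eqP rL := L_free.
apply: leq_trans (mxrankS LV); rewrite rL.
case: m m0 @S {L LV L_free rL} => // m' _ S.
have -> : multichoose N m'.+1 = 'C(m' + N, m').
  by rewrite /multichoose addnS /= addnC -bin_sub ?leq_addl // addnK.
rewrite -card_ord_partitions.
pose f (t : m'.+1.-tuple 'I_N.+1) := [ffun i => tnth t i].
have f_inj : injective f.
  by move=> t u /ffunP e; apply: eq_from_tnth => i; have := e i; rewrite !ffunE.
rewrite -(card_imset _ f_inj); apply/subset_leq_card/subsetP => _ /imsetP[t + ->].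
rewrite !inE big_tuple => /eqP e; apply/eqP; rewrite -[RHS]e.
by apply: eq_bigr => i _; rewrite ffunE.
Qed.

Definition fun_row (xi : 'I_m -> F) : 'rV[F]_m := \row_j xi j.

Local Notation unip := (unip (@shift_mx m N F)).

Lemma Zvec_embed (xi : 'I_m -> F) (k : O) : inTheta k ->
  Zvec xi k *m J = row (enum_rank (val k)) (unip (fun_row xi)).
Proof.
move=> kT; apply/rowP => c; rewrite !mxE /unip /der summxE.
have -> : \sum_i (fun_row xi 0 i *: shift_mx N F i) (enum_rank (val k)) c =
    \sum_j (below (val k) (enum_val c) j)%:R * xi j.
  by apply: eq_bigr => j _; rewrite !mxE enum_rankK mulrC.
have -> : (enum_rank (val k) == c) = (enum_val c == val k).
  by rewrite -(inj_eq enum_val_inj) enum_rankK eq_sym.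
have [cO|cO] := boolP (N.-1 <= weight (enum_val c) <= N)%N.
  pose l : O := Sub (enum_val c) cO.
  rewrite (bigD1 (enum_rank l)) //= big1 ?addr0.
    rewrite !mxE enum_rankK eqxx mulr1 /Zcoef -(inj_eq val_inj) /=.
    congr (_ + _); apply: eq_bigr => j _; congr (_%:R * _).
    by rewrite belowE.
  move=> b bl; rewrite !mxE; case: eqP => [e|_]; last by rewrite mulr0.
  case/eqP: bl; rewrite -[b]enum_valK; congr enum_rank.
  exact/val_inj/esym.
rewrite big1 => [|b _]; last first.
  rewrite !mxE; case: eqP => [e|_]; last by rewrite mulr0.
  by have := valP (enum_val b); rewrite /= -e (negbTE cO).
(* An index below [val k] has weight [N - 1], so it lies in [Omega]. *)
rewrite big1 => [|j _]; last first.
  case b: below; last by rewrite mul0r.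
  by have := weight_below b; have := eqP kT; move: cO; lia.
by rewrite addr0; case: eqP => // e; move: cO; rewrite e (valP k).
Qed.

(** The diagonal projection [V N] keeps exactly the rows of [unip] indexed by weight [N], which are
    the embedded [Zvec]. *)
Lemma Fspace_embed (xi : 'I_m -> F) :
  (Fspace N xi *m J :=: V N *m unip (fun_row xi))%MS.
Proof.
apply/eqmxP/andP; split.
  rewrite /Fspace sumsmxMr_gen; apply/sumsmx_subP => k kT.
  rewrite genmxE (eqmxMr _ (genmxE _)) Zvec_embed //.
  have -> : row (enum_rank (val k)) (unip (fun_row xi)) =
      row (enum_rank (val k)) (V N *m unip (fun_row xi)).
    by rewrite row_mul; apply/rowP => c; rewrite row_diag_mx -scalemxAl -rowE !mxE enum_rankK (eqP kT) eqxx mul1r.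
  exact: row_sub.
apply/row_subP => a; rewrite row_mul row_diag_mx -scalemxAl -rowE mxE.
have [w|_] := eqVneq; last by rewrite scale0r sub0mx.
have aO : (N.-1 <= weight (enum_val a) <= N)%N by rewrite w leqnn leq_pred.
pose k : O := Sub (enum_val a) aO.
have kT : inTheta k by rewrite /inTheta /= w.
have := Zvec_embed xi kT; rewrite /= enum_valK scale1r => <-.
apply: submxMr; rewrite /Fspace; apply: (sumsmx_sup k) => //; by rewrite genmxE.
Qed.

End Embedding.

(** * Transfer to the generic point *)

Section Transfer.
Variables (K C : fieldType) (iota : {rmorphism K -> C}).
Hypothesis closedK : forall p : {poly K}, (1 < size p)%N -> exists x, root p x.
Variables (m n : nat) (xi : 'I_m -> C).
Local Notation N := n.+1.
Hypothesis indep : forall (c0 : K) (c : 'I_m -> K),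
  iota c0 + \sum_j iota (c j) * xi j = 0 -> forall j, c j = 0.
Hypothesis m_gt0 : (0 < m)%N.

Lemma rank_weight_unip (F : fieldType) (z : 'rV[F]_m) :
  \rank (weight_mx m N F N *m unip (@shift_mx m N F) z) = multichoose N m.
Proof.
rewrite (rank_V_unip (@weight_shift_mx m N F) (@weight_mx_direct m N F)).
exact: rank_weight_mx_top.
Qed.

Lemma rank_cap_embed s (B : 'M[C]_(s, #|{: Omega m N}|)) :
  (\rank (Fspace N xi :&: B) + \rank (col_mx
      (weight_mx m N C N *m unip (@shift_mx m N C) (fun_row xi)) (B *m embed m N C)) =
   multichoose N m + \rank B)%N.
Proof.
have Jf := embed_free m N C.
have rF : \rank (Fspace N xi) = multichoose N m.
  by rewrite -(mxrankMfree _ Jf) Fspace_embed rank_weight_unip.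
rewrite -rF -mxrank_sum_cap addnC; congr (_ + _)%N.
rewrite -addsmxE -(mxrankMfree (_ + _)%MS Jf) addsmxMr.
by apply/eqmx_rank/eqmxP/adds_eqmx => //; apply: eqmx_sym; exact: Fspace_embed.
Qed.

Lemma proper_hyperplane (H : 'M[K]_m) : (\rank H < m)%N ->
  exists c : 'I_m -> K, (exists j, c j != 0) /\
    forall x : 'rV_m, (x <= H)%MS -> \sum_j x 0 j * c j = 0.
Proof.
move=> rH; have : cokermx H != 0.
  by rewrite -mxrank_eq0 mxrank_coker; lia.
case/matrix0Pn => i [j ij]; exists (fun a => cokermx H a j); split; first by exists i.
by move=> x; rewrite submxE => /eqP /matrixP /(_ 0 j); rewrite !mxE.
Qed.

Variables (s : nat) (B : 'M[K]_(s, #|{: Omega m N}|)).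
Local Notation BC := (map_mx iota B).
Local Notation X := <<B *m embed m N K>>%MS.
Local Notation fiberX := (fiber (@shift_mx m N K) (weight_mx m N K) N X).

(** Specialization can only lower the rank of the stacked matrix, hence only enlarge the
    intersection; a suitable nonzero [g] keeps the point off a given finite list. *)
Lemma specialize_dense :
  affinely_dense (fun z => (\rank (Fspace N xi :&: BC) <= \rank (fiberX z))%N).
Proof.
have [A [al [c [x [spec alc alx]]]]] := specializable_point closedK iota xi.
move=> l lP.
have [g [alg gP]] : exists g : A, al g != 0 /\
    forall be : {rmorphism A -> K}, (forall a, be (c a) = a) -> be g != 0 ->
    avoids (\row_j be (x j)) l.
  elim: l lP => [_|[a H] l IHl /=].
    by exists 1; rewrite rmorph1 oner_eq0.
  move=> /andP[rH /IHl [g [alg gP]]].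
  have [h [[j0 hj0] hP]] := proper_hyperplane rH.
  (* The equation of a hyperplane containing [a + H], at the generic point; if [al] killed it,
     [indep] would give [h j0 = 0]. *)
  pose L := \sum_j (x j - c (a 0 j)) * c (h j).
  exists (L * g); split.
    rewrite rmorphM mulf_neq0 //; apply: contraNneq hj0 => L0.
    rewrite (@indep (- \sum_j a 0 j * h j) h) ?eqxx //.
    rewrite -[RHS]L0 rmorph_sum rmorphN rmorph_sum -sumrN -big_split /=.
    apply: eq_bigr => j _; rewrite !rmorphM rmorphB /= !alc alx; ring.
  move=> be bec; rewrite rmorphM mulf_eq0 negb_or => /andP[beL beg].
  rewrite /avoids /= -/(avoids _ l) gP // andbT.
  apply: contra beL => /hP eqL; rewrite -[X in _ == X]eqL rmorph_sum /=.
  by apply/eqP/eq_bigr => j _; rewrite rmorphM rmorphB /= !bec !mxE.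
have [be [bec beg be_ker]] := spec g alg.
exists (\row_j be (x j)); last exact: gP.
(* One matrix over [A] whose images under [be] and [al] are the stacked matrices over [K] and
   [C]. *)
pose T : 'M[A]_(_, _) := col_mx (weight_mx m N A N *m (1%:M + \sum_j x j *: shift_mx N A j))
  (map_mx c B *m embed m N A).
have T_map (F : fieldType) (f : {rmorphism A -> F}) : map_mx f T = col_mx
    (weight_mx m N F N *m unip (@shift_mx m N F) (fun_row (f \o x)))
    (map_mx f (map_mx c B) *m embed m N F).
  rewrite map_col_mx !map_mxM map_weight_mx map_embed map_mxD map_mx1; congr col_mx.
  rewrite /unip /der; congr (_ *m (_ + _)); rewrite raddf_sum; apply: eq_bigr => j _ /=.
  by rewrite map_mxZ map_shift_mx mxE.
have := rank_specialize T be_ker; rewrite !T_map.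
have -> : map_mx be (map_mx c B) = B by apply/matrixP => i j; rewrite !mxE.
have -> : map_mx al (map_mx c B) = BC by apply/matrixP => i j; rewrite !mxE.
have -> : fun_row (al \o x) = fun_row xi by apply/rowP => j; rewrite !mxE /= alx.
have -> : fun_row (be \o x) = \row_j be (x j) by apply/rowP => j; rewrite !mxE.
set z := \row_j _.
have := rank_cap_embed BC; rewrite mxrank_map.
have := mxrank_sum_cap (weight_mx m N K N *m unip (@shift_mx m N K) z) X.
have -> : \rank X = \rank B by rewrite genmxE mxrankMfree // embed_free.
rewrite (adds_eqmx (eqmx_refl _) (genmxE _)) addsmxE rank_weight_unip.
set a := \rank (col_mx _ _); set b := \rank (col_mx _ _).
by move=> eqK eqC le_rank; rewrite -(leq_add2l a) eqK -eqC addnC leq_add2l.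
Qed.

Lemma genmx_embed_sub : (X <= weight_mx m N K N + weight_mx m N K n)%MS.
Proof.
rewrite genmxE; apply: submx_trans (submxMl _ _) _; exact: (embed_sub m N K).
Qed.

Lemma transfer_ineq :
  ((n.*2 + m).+1 * \rank (Fspace N xi :&: BC) <= (n + m) * \rank B)%N.
Proof.
have := dense_fiber_ineq (@shift_mxC m N K) (@weight_shift_mx m N K)
  (@weight_mx_direct m N K) (@shift_mx_inj m N K) (@rank_weight_mx0 m N K)
  genmx_embed_sub specialize_dense (fun z zZ => zZ).
by rewrite genmxE mxrankMfree ?embed_free.
Qed.

Lemma transfer_eq :
  ((n.*2 + m).+1 * \rank (Fspace N xi :&: BC) = (n + m) * \rank B)%N <->
  \rank B = 0%N \/ row_full B.
Proof.
split=> [eqB|[B0|fullB]].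
- have := dense_fiber_eq (@shift_mxC m N K) (@weight_shift_mx m N K)
    (@weight_mx_direct m N K) (@shift_mx_inj m N K) (@rank_weight_mx0 m N K)
    m_gt0 genmx_embed_sub specialize_dense (fun z zZ => zZ).
  rewrite genmxE mxrankMfree ?embed_free // => /(_ eqB) [->|rB]; [by left|right].
  rewrite /row_full eqn_leq rank_leq_col rB; exact: (card_Omega_le m N K).
- have := mxrankS (capmxSr (Fspace N xi) BC); rewrite mxrank_map B0 leqn0 => /eqP ->.
  by rewrite !muln0.
apply/eqP; rewrite eqn_leq transfer_ineq /=.
have -> : \rank (Fspace N xi :&: BC) = multichoose N m.
  have -> : \rank (Fspace N xi :&: BC) = \rank (Fspace N xi).
    apply/eqP; rewrite eqn_leq !mxrankS ?capmxSl // sub_capmx submx_refl /=.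
    by rewrite submx_full // /row_full mxrank_map.
  by rewrite -(mxrankMfree _ (embed_free m N C)) Fspace_embed rank_weight_unip.
(* By [multichoose_down], the upper bound for the right side is exactly
   [(n.*2 + m).+1 * multichoose N m]. *)
rewrite (eqP fullB); apply: leq_trans (leq_mul (leqnn _) (card_Omega_le m N K)) _.
rewrite mulnDr multichoose_down -mulnDl leq_mul2r -muln2; apply/orP; right; lia.
Qed.

End Transfer.

(** * The algebraically closed field of algebraic numbers *)

Section AlgebraicNumbers.
Variable C : numClosedFieldType.

Definition algebraic_pred : {pred C} := fun x => `[< algebraicQ x >].

Lemma algebraic_predP x : reflect (algebraicQ x) (x \in algebraic_pred).
Proof. exact: asboolP. Qed.

Lemma algebraic_pred_divring : divring_closed algebraic_pred.
Proof.
split=> [|x y /algebraic_predP xA /algebraic_predP yA|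
  x y /algebraic_predP xA /algebraic_predP yA]; apply/algebraic_predP.
- exact: algebraic1.
- exact: algebraic_sub.
- exact: algebraic_div.
Qed.

HB.instance Definition _ :=
  GRing.isDivringClosed.Build C algebraic_pred algebraic_pred_divring.

Record Qbar := InQbar {Qbar_val :> C; _ : Qbar_val \in algebraic_pred}.

HB.instance Definition _ := [isSub for Qbar_val].
HB.instance Definition _ := [Choice of Qbar by <:].
HB.instance Definition _ := [SubChoice_isSubIntegralDomain of Qbar by <:].
HB.instance Definition _ := [SubIntegralDomain_isSubField of Qbar by <:].

Definition Qbar_inj : {rmorphism Qbar -> C} := \val.

Lemma Qbar_algebraic (x : Qbar) : algebraicQ (Qbar_inj x).
Proof. exact/algebraic_predP/(valP x). Qed.

Lemma algebraic_Qbar (x : C) : algebraicQ x -> exists y : Qbar, Qbar_inj y = x.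
Proof. by move=> /algebraic_predP xA; exists (InQbar xA). Qed.

(** A root exists in [C]; being integral over algebraic numbers, it is algebraic by transitivity. *)
Lemma Qbar_closed (p : {poly Qbar}) : (1 < size p)%N -> exists x, root p x.
Proof.
move=> sp; have [|x px] := closed_rootP (map_poly Qbar_inj p) _.
  by rewrite size_map_poly neq_ltn sp orbT.
have /algebraic_Qbar [y yx] : algebraicQ x.
  apply/integral_algebraic; apply: integral_root px _.
    by rewrite map_poly_eq0 -size_poly_gt0 ltnW.
  apply/integral_poly => i; rewrite coef_map; exact/integral_algebraic/Qbar_algebraic.
by exists y; rewrite -(fmorph_root Qbar_inj) yx.
Qed.

End AlgebraicNumbers.

Theorem theorem4 (R : realType) (m N : nat) (xi : 'I_m -> R[i])
  (hm : (1 <= m)%N) (hN : (1 <= N)%N)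
  (hindep : forall (c0 : R[i]) (c : 'I_m -> R[i]),
      algebraicQ c0 -> (forall j, algebraicQ (c j)) ->
      c0 + \sum_(j < m) c j * xi j = 0 -> c0 = 0 /\ (forall j, c j = 0))
  (r : nat) (Rs : 'M[R[i]]_(r, #|Omega m N|)) (hR : defined_over_Qbar Rs) :
  let dimR : rat := (\rank Rs)%:R in
  let dimFR : rat := (\rank (Fspace N xi :&: Rs))%:R in
  let c : rat := 2 - (m%:R - 1) / (N%:R + m%:R - 1) in
  c * dimFR <= dimR /\
  (dimR = c * dimFR <-> (Rs == 0 \/ row_full Rs)).
Proof.
case: N hN Rs hR => // n _ Rs [s [B [B_alg RsB]]] dimR dimFR c.
pose iota := Qbar_inj R[i].
have [B' B'E] : exists B' : 'M_(s, _), map_mx iota B' = B.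
  have /fin_all_exists [f fE] (ij : 'I_s * 'I_#|Omega m n.+1|) :
    exists y, iota y = B ij.1 ij.2 by exact/algebraic_Qbar.
  by exists (\matrix_(i, j) f (i, j)); apply/matrixP => i j; rewrite !mxE fE.
have indep (c0 : Qbar R[i]) (a : 'I_m -> Qbar R[i]) :
    iota c0 + \sum_j iota (a j) * xi j = 0 -> forall j, a j = 0.
  move=> /hindep [|j|_ a0 j]; try exact: Qbar_algebraic.
  by apply/eqP; rewrite -(fmorph_eq0 iota) a0.
have eqRs : (Rs :=: map_mx iota B')%MS by apply/eqmxP; rewrite B'E.
have rRs : \rank Rs = \rank B' by rewrite eqRs mxrank_map.
have rFR : \rank (Fspace n.+1 xi :&: Rs) = \rank (Fspace n.+1 xi :&: map_mx iota B').
  by rewrite (cap_eqmx (eqmx_refl _) eqRs).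
have nm0 : (n + m)%:R != 0 :> rat by rewrite pnatr_eq0; lia.
have nm_gt0 : 0 < (n + m)%:R :> rat by rewrite lt0r nm0 ler0n.
(* With [N = n.+1], the constant is the ratio of the two integer coefficients in [transfer_ineq]. *)
have cE : c = (n.*2 + m).+1%:R / (n + m)%:R.
  have -> : (n.*2 + m).+1%:R = n%:R * 2 + m%:R + 1 :> rat.
    by rewrite -addn1 -muln2 !natrD natrM.
  rewrite /c -[n.+1%:R]natr1; move: nm0; rewrite !natrD => nm0.
  by field.
have cmul : c * dimFR =
    ((n.*2 + m).+1 * \rank (Fspace n.+1 xi :&: map_mx iota B'))%:R / (n + m)%:R.
  by rewrite cE /dimFR rFR natrM mulrAC.
have ineq := transfer_ineq (@Qbar_closed R[i]) indep hm B'.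
have eqv := transfer_eq (@Qbar_closed R[i]) indep hm B'.
rewrite cmul /dimR rRs; split.
  by rewrite ler_pdivrMr // -natrM ler_nat [leqRHS]mulnC.
have -> : Rs == 0 \/ row_full Rs <-> \rank B' = 0%N \/ row_full B'.
  rewrite /row_full rRs -mxrank_eq0 rRs.
  by split=> -[/eqP|]; [left|right|left|right].
rewrite -eqv; split=> e.
  apply/eqP; rewrite -(eqr_nat rat) [X in _ == X]natrM e.
  by rewrite [X in _ == X]mulrC divfK.
by rewrite e mulnC natrM mulfK.
Qed.
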